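(* For integers $m,n\ge 1$, let $\mathrm{Queen}_{m,n}$ be the $m\times n$ queen graph and let $\mathcal{R}$ denote the representation number. Then: \begin{itemize} \item $\mathcal{R}(\mathrm{Queen}_{m,n})=1$ if $m=1$ or $n=1$, or $m=n=2$; \item $\mathcal{R}(\mathrm{Queen}_{2,n})=\mathcal{R}(\mathrm{Queen}_{n,2})=2$ for $n\in\{3,4\}$; \item $\mathcal{R}(\mathrm{Queen}_{2,n})=\mathcal{R}(\mathrm{Queen}_{n,2})=3$ for all $n\ge 5$; \item $\mathcal{R}(\mathrm{Queen}_{m,n})=\infty$ for all $m,n\ge 3$. \end{itemize}
   Context: All graphs are finite, simple and undirected. Two distinct letters $x,y$ alternate in a word $w$ if deleting from $w$ all letters other than $x$ and $y$ leaves a word of the form $xyxy\cdots$ or $yxyx\cdots$ (of even or odd length). A word $w$ over the alphabet $V$, in which every letter of $V$ occurs, represents a graph $G=(V,E)$ if for all distinct $x,y\in V$: $x$ and $y$ alternate in $w$ if and only if $(x,y)\in E$. $G$ is word-representable if some word represents it. $G$ is $k$-representable if it is represented by a word in which each letter appears exactly $k$ times. The representation number $\mathcal{R}(G)$ is the smallest integer $k\ge 1$ such that $G$ is $k$-representable; $\mathcal{R}(G)=\infty$ if $G$ is not word-representable. (Every word-representable graph is $k$-representable for some $k$.) The queen graph $\mathrm{Queen}_{m,n}$ has vertex set $\{x_{i,j}: 1\le i\le m,\ 1\le j\le n\}$ (the squares of an $m\times n$ chessboard), and two distinct vertices $x_{a,b}$, $x_{c,d}$ are adjacent if and only if the squares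 lie in the same row, column or diagonal, i.e. $a=c$ or $b=d$ or $|a-c|=|b-d|$. *)

(* Defs.v *)
From mathcomp Require Import all_boot all_order all_algebra.

Set Implicit Arguments.
Unset Strict Implicit.
Unset Printing Implicit Defensive.

Record sgraph := SGraph {
  vertex :> finType;
  edge : rel vertex;
  edge_sym : symmetric edge;
  edge_irrefl : irreflexive edge
}.

(* The word x y x y ... of length n, with n even or odd. *)
Definition alt_word (T : Type) (x y : T) (n : nat) : seq T :=
  mkseq (fun i => if odd i then y else x) n.

Definition alternate (T : eqType) (x y : T) (w : seq T) : Prop :=
  let u := [seq z <- w | (z == x) || (z == y)] in
  exists n, u = alt_word x y n \/ u = alt_word y x n.

Definition represents (G : sgraph) (w : seq G) : Prop :=
  (forall x : G, x \in w) /\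
  (forall x y : G, x != y -> (alternate x y w <-> edge x y)).

Definition word_representable (G : sgraph) : Prop :=
  exists w : seq G, represents w.

Definition k_representable (k : nat) (G : sgraph) : Prop :=
  exists w : seq G, represents w /\ (forall x : G, count_mem x w = k).

(* The representation number takes values in the positive integers extended
   by infinity, encoded in [option nat] with [None] for infinity. It is given
   by its graph: [repr_number G r] reads "R(G) = r". *)
Definition repr_number (G : sgraph) (r : option nat) : Prop :=
  match r with
  | Some k => [/\ 1 <= k, k_representable k G
                & forall j, 1 <= j -> k_representable j G -> k <= j]
  | None => ~ word_representable G
  end.

Lemma repr_number_inj (G : sgraph) (r s : option nat) :
  repr_number G r -> repr_number G s -> r = s.
Proof.
case: r s => [k|] [j|] //=.
- move=> [k1 Gk kmin] [j1 Gj jmin]; congr Some; apply/eqP.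
  by rewrite eqn_leq kmin ?jmin.
- by move=> [_ [w [Gw _]] _] []; exists w.
- by move=> nG [_ [w [Gw _]] _]; case: nG; exists w.
Qed.

(* Squares are indexed from 0; the distances are those of the integers. *)
Definition queen_edge (m n : nat) : rel ('I_m * 'I_n) :=
  fun p q => (p != q) &&
    [|| p.1 == q.1, p.2 == q.2
      | `|(p.1 : nat) - (q.1 : nat)|%N == `|(p.2 : nat) - (q.2 : nat)|%N].

Lemma queen_edge_sym (m n : nat) : symmetric (@queen_edge m n).
Proof.
move=> p q; rewrite /queen_edge eq_sym (eq_sym p.1) (eq_sym p.2).
by rewrite distnC (distnC p.2).
Qed.

Lemma queen_edge_irrefl (m n : nat) : irreflexive (@queen_edge m n).
Proof. by move=> p; rewrite /queen_edge eqxx. Qed.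

Definition Queen (m n : nat) : sgraph :=
  SGraph (@queen_edge_sym m n) (@queen_edge_irrefl m n).

(* Main.v *)
Require Import Defs.
From mathcomp Require Import all_boot all_order all_algebra.
From mathcomp Require Import zify.

Set Implicit Arguments.
Unset Strict Implicit.
Unset Printing Implicit Defensive.

(** A graph is 1-representable exactly when it is complete, and
    k-representability passes to induced subgraphs.

    Two rows.  Write a_j, b_j for the squares of the two rows, so that a_j and
    b_k are adjacent iff |j - k| <= 1.  For the word B M1 A M2, where A and B
    list the rows, M1 sorts all squares so that a_j precedes b_k iff j <= k+1,
    and M2 so that b_k precedes a_j iff k <= j+1, the restriction to a_j, b_k
    is alternating iff it is b(ab)a(ba), i.e. iff
    |j - k| <= 1; hence R <= 3.  For five or more columns, columns 0, 2 and 4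
    induce the triangular prism, which an exhaustive search that inserts the
    letters one by one shows not to be 2-representable.

    Three rows and columns.  The centre c of a 3 x 3 board is adjacent to the
    eight other squares.  For x alternating with c, let e_x be the number of
    x's minus the number of c's in a prefix, plus one if c comes first;
    then e_x takes values in {0, 1}, and x, y alternate iff e_x and e_y are
    comparable pointwise.  So the other eight squares induce a comparability
    graph; but they induce the complement of an 8-cycle, which is not one. *)

(** * Boolean alternation and restriction of words *)

(** As [!=] is not transitive, [sorted] compares only neighbours: the restriction to two letters
    alternates iff no letter stands next to itself. *)
Definition altb (T : eqType) (x y : T) (w : seq T) :=
  sorted (fun a b => a != b) [seq z <- w | (z == x) || (z == y)].

Section Alternation.
Variable T : eqType.
Implicit Types (x y z : T) (w : seq T).

Lemma altbC x y w : altb x y w = altb y x w.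
Proof. by rewrite /altb; under eq_filter do rewrite orbC. Qed.

Lemma alt_wordS x y n : alt_word x y n.+1 = x :: alt_word y x n.
Proof.
rewrite /alt_word /mkseq /= -[1]/(0.+1) -add1n iotaDl -map_comp; congr cons.
by apply: eq_map => i /=; case: (odd i).
Qed.

Lemma alt_word_path x y n :
  x != y -> path (fun a b => a != b) x (alt_word y x n).
Proof.
elim: n x y => [|n IHn] x y xy //; rewrite alt_wordS /= xy IHn //.
by rewrite eq_sym.
Qed.

Lemma path_alt_word x y u :
  all (fun z => (z == x) || (z == y)) u ->
  path (fun a b => a != b) x u -> u = alt_word y x (size u).
Proof.
elim: u x y => [|z u IHu] x y //= /andP[zxy uxy] /andP[xz pu].
have zy : z = y by move: zxy; rewrite eq_sym (negPf xz) => /eqP.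
subst z; rewrite alt_wordS; congr cons; apply: IHu => //.
by apply: sub_all uxy => z; rewrite orbC.
Qed.

Lemma alternateP x y w : x != y -> reflect (alternate x y w) (altb x y w).
Proof.
move=> xy; rewrite /altb /alternate; set u := filter _ w.
have uxy : all (fun z => (z == x) || (z == y)) u by exact: filter_all.
apply: (iffP idP) => [|[n [->|->]]].
- case: u uxy => [|z u] /=; first by exists 0; left.
  case/andP=> /orP[]/eqP-> uxy pu; exists (size u).+1.
  + by left; rewrite alt_wordS -path_alt_word.
  + right; rewrite alt_wordS -path_alt_word //.
    by apply: sub_all uxy => t; rewrite orbC.
- by case: n => // n; rewrite alt_wordS /= alt_word_path.
- by case: n => // n; rewrite alt_wordS /= alt_word_path // eq_sym.
Qed.

Lemma altb_filter (P : pred T) x y w :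
  P x -> P y -> altb x y (filter P w) = altb x y w.
Proof.
move=> Px Py; rewrite /altb -filter_predI; congr sorted.
by apply: eq_filter => z /=; do 2?case: eqP => [->|_].
Qed.

Lemma filter_pair x y w :
  x != y -> count_mem x w = 1 -> count_mem y w = 1 ->
  let u := [seq z <- w | (z == x) || (z == y)] in
  u = [:: x; y] \/ u = [:: y; x].
Proof.
move=> xy wx wy u.
have size_u : size u = 2.
  have := count_predUI (pred1 x) (pred1 y) w; rewrite wx wy -size_filter.
  rewrite [X in _ + X](_ : _ = 0) ?addn0 // -(count_pred0 w).
  by apply: eq_count => z /=; case: eqP => // ->; rewrite (negPf xy).
have mem_u t : (t == x) || (t == y) -> count_mem t w = 1 -> t \in u.
  by move=> txy wt; rewrite mem_filter txy -has_pred1 has_count wt.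
have := mem_u y; have := mem_u x; rewrite !eqxx orbT.
move=> /(_ isT wx) + /(_ isT wy); case: (u) size_u => [|a [|b []]] //= _.
rewrite !inE => /orP[]/eqP <- /orP[]/eqP e; subst; rewrite ?eqxx // in xy.
  by left.
by right.
Qed.

End Alternation.

Lemma altb_map (T U : eqType) (f : T -> U) x y w :
  injective f -> altb (f x) (f y) (map f w) = altb x y w.
Proof.
move=> f_inj; rewrite /altb filter_map sorted_map.
under eq_filter do rewrite /= !(inj_eq f_inj).
by apply: eq_sorted => a b /=; rewrite (inj_eq f_inj).
Qed.

(** * Representability, induced subgraphs and small representation numbers *)

Lemma representsP (G : sgraph) (w : seq G) :
  represents w <-> (forall x, x \in w) /\
                   (forall x y : G, x != y -> altb x y w = edge x y).
Proof.
split=> -[w_full w_alt]; split=> // x y xy.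
  by apply/(alternateP _ xy)/idP => /w_alt-/(_ xy).
by rewrite -w_alt //; split=> /(alternateP w xy).
Qed.

Lemma k_representableP k (G : sgraph) : 0 < k ->
  k_representable k G <->
  exists w : seq G, (forall x, count_mem x w = k) /\
                    (forall x y, x != y -> altb x y w = edge x y).
Proof.
move=> k_gt0; split=> -[w].
  by case=> /representsP[_ w_alt] wk; exists w.
case=> wk w_alt; exists w; split=> //; apply/representsP; split=> // x.
by rewrite -has_pred1 has_count wk.
Qed.

Lemma k_representable_induced k (G H : sgraph) (f : G -> H) :
  0 < k -> injective f -> {mono f : x y / edge x y} ->
  k_representable k H -> k_representable k G.
Proof.
move=> k_gt0 f_inj f_edge /(k_representableP _ k_gt0)[w [wk w_alt]].
(* [g] is the partial inverse of [f], so [pmap g] deletes the letters outside the image and renames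
   the others. *)
pose g z := [pick x | f x == z].
have fg : ocancel g f.
  by move=> z; rewrite /g; case: pickP => //= x /eqP.
have gf x : g (f x).
  by rewrite /g; case: pickP => // /(_ x); rewrite eqxx.
have fw : map f (pmap g w) = [seq z <- w | g z] by exact: pmap_filter.
apply/(k_representableP _ k_gt0); exists (pmap g w); split=> [x|x y xy].
  rewrite -(wk (f x)) -(eq_count (inj_eq f_inj ^~ x)) -(count_map f (pred1 (f x))).
  rewrite fw count_filter; apply: eq_count => z /=.
  by case: eqP => // ->; rewrite gf.
by rewrite -(altb_map _ _ _ f_inj) fw altb_filter // w_alt ?(inj_eq f_inj) // f_edge.
Qed.

Definition complete (G : sgraph) := forall x y : G, x != y -> edge x y.

Lemma one_representableE (G : sgraph) : k_representable 1 G <-> complete G.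
Proof.
split=> [/k_representableP[] // w [w1 w_alt] x y xy|compl].
  rewrite -w_alt // /altb.
  by case: (filter_pair xy (w1 x) (w1 y)) => -> /=; rewrite ?xy // eq_sym xy.
have w1 (x : G) : count_mem x (enum G) = 1.
  by rewrite count_uniq_mem ?enum_uniq // mem_enum.
apply/k_representableP => //; exists (enum G); split=> // x y xy.
rewrite compl // /altb.
by case: (filter_pair xy (w1 x) (w1 y)) => -> /=; rewrite ?xy // eq_sym xy.
Qed.

Lemma repr_number1 (G : sgraph) : complete G -> repr_number G (Some 1).
Proof. by move=> compl; split=> //; apply/one_representableE. Qed.

Lemma repr_number2 (G : sgraph) :
  ~ complete G -> k_representable 2 G -> repr_number G (Some 2).
Proof.
by move=> ncompl G2; split=> // -[//|[|//]] _ /one_representableE /ncompl.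
Qed.

Lemma repr_number3 (G : sgraph) :
  ~ k_representable 2 G -> ~ complete G -> k_representable 3 G ->
  repr_number G (Some 3).
Proof.
move=> nG2 ncompl G3; split=> // -[//|[|[|//]]] _; last by move/nG2.
by move=> /one_representableE /ncompl.
Qed.

Lemma repr_number_iso (G H : sgraph) (f : G -> H) (g : H -> G) r :
  cancel f g -> cancel g f -> {mono f : x y / edge x y} ->
  0 < r -> repr_number G (Some r) -> repr_number H (Some r).
Proof.
move=> fK gK f_edge r_gt0 [_ Gr r_min].
have g_edge : {mono g : x y / edge x y} by move=> x y; rewrite -f_edge !gK.
split=> // [|j j_gt0 /(k_representable_induced j_gt0 (can_inj fK) f_edge)].
  exact: k_representable_induced (can_inj gK) g_edge Gr.
exact: r_min.
Qed.

(** * Transposition and adjacency on boards with two rows *)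

Lemma repr_number_Queen_tr m n r :
  0 < r -> repr_number (Queen m n) (Some r) -> repr_number (Queen n m) (Some r).
Proof.
pose tr i j (p : Queen i j) : Queen j i := (p.2, p.1).
have trK i j : cancel (@tr i j) (@tr j i) by case.
apply: repr_number_iso (trK m n) (trK n m) _ => -[a b] [c d] /=.
by rewrite /queen_edge !xpair_eqE /= [(b == d) && _]andbC orbCA
           [absz _ == _]eq_sym.
Qed.

Lemma queen2_edge_same n (i : 'I_2) (j k : 'I_n) :
  j != k -> queen_edge (i, j) (i, k).
Proof. by move=> jk; rewrite /queen_edge xpair_eqE /= !eqxx /= jk. Qed.

Lemma queen2_edge_diff n (j k : 'I_n) :
  queen_edge (ord0 : 'I_2, j) (ord_max, k) = (j <= k.+1) && (k <= j.+1) :> bool.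
Proof. by rewrite /queen_edge xpair_eqE /= -!val_eqE /=; lia. Qed.

Lemma not_complete_Queen2 n : 3 <= n -> ~ complete (Queen 2 n).
Proof.
case: n => [|[|[|n]]] // _ /(_ (ord0, ord0) (ord_max, inord 2)) /=.
by rewrite queen2_edge_diff inordK // => /(_ isT).
Qed.

Lemma queen2_pairP n (P : 'I_2 * 'I_n -> 'I_2 * 'I_n -> Prop) :
  (forall p q, P p q -> P q p) ->
  (forall i (j k : 'I_n), j < k -> P (i, j) (i, k)) ->
  (forall j k, P (ord0, j) (ord_max, k)) ->
  forall p q, p != q -> P p q.
Proof.
move=> Psym Psame Pdiff.
have ordP (i : 'I_2) : i = ord0 \/ i = ord_max.
  by case: i => [[|[|//]] ?]; [left|right]; apply: val_inj.
move=> [i j] [i' k]; have [->|] := eqVneq i i'.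
  rewrite xpair_eqE eqxx /= -val_eqE neq_ltn => /orP[] jk; first exact: Psame.
  exact/Psym/Psame.
move=> + _; case: (ordP i) => ->; case: (ordP i') => -> //= _.
exact/Psym.
Qed.

(** * Blocks: letters listed once each by increasing key *)

Section Blocks.
Variable T : finType.
Implicit Types (key : T -> nat) (P : pred T) (p q : T).

Definition block key P := filter P (sort (relpre key leq) (enum T)).

Lemma count_sort_enum key p : count_mem p (sort (relpre key leq) (enum T)) = 1.
Proof.
by rewrite (permP (permEl (perm_sort _ _))) count_uniq_mem ?enum_uniq ?mem_enum.
Qed.

Lemma count_block key P p : count_mem p (block key P) = P p.
Proof.
rewrite count_filter; case: (boolP (P p)) => [Pp|nPp].
  rewrite -[RHS](count_sort_enum key p); apply: eq_count => q /=.
  by case: eqP => // ->.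
rewrite -[RHS](count_pred0 (sort (relpre key leq) (enum T))).
by apply: eq_count => q /=; case: eqP => // ->; apply: negPf.
Qed.

(** Sorting leaves only ties open, so distinct keys fix the order of [p] and [q]. *)
Lemma filter_block key P p q : key p != key q ->
  [seq z <- block key P | (z == p) || (z == q)] =
  filter P (if key p < key q then [:: p; q] else [:: q; p]).
Proof.
move=> pq; have p_neq_q : p != q by apply: contra_neq pq => ->.
transitivity [seq z <- [seq z <- sort (relpre key leq) (enum T) |
                          (z == p) || (z == q)] | P z].
  by rewrite -!filter_predI; apply: eq_filter => z; rewrite /= andbC.
congr filter; set s := sort _ _.
have : sorted (relpre key leq) [seq z <- s | (z == p) || (z == q)].
  apply: sorted_filter; first by move=> a b c; apply: leq_trans.
  by apply: sort_sorted => a b; apply: leq_total.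
case: (filter_pair p_neq_q (count_sort_enum key p) (count_sort_enum key q)) => -> /=.
  by rewrite leq_eqVlt (negPf pq) => /= /andP[->].
by rewrite andbT ltnNge => ->.
Qed.

End Blocks.

(** * A word with three copies of each letter for two rows *)

Section ThreeRepresentation.
Variable n : nat.
Notation V := ('I_2 * 'I_n)%type.

(** The offset 3 is odd, so squares of different rows never tie, and 2j < 2k + 3 means j <= k + 1.
    [key2] exchanges the rows. *)
Definition key1 (p : V) := if p.1 == ord0 then 2 * p.2 else 2 * p.2 + 3.
Definition key2 (p : V) := if p.1 == ord0 then 2 * p.2 + 3 else 2 * p.2.

(* The word B M1 A M2; [key1] sorts M1 and [key2] sorts M2. *)
Definition word3 :=
  block key2 (fun p => p.1 != ord0) ++ block key1 predT ++
  block key1 (fun p => p.1 == ord0) ++ block key2 predT.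

Lemma Queen2_3representable : k_representable 3 (Queen 2 n).
Proof.
apply/k_representableP => //; exists word3; split=> [p|].
  by rewrite !count_cat !count_block; case: eqP.
apply: queen2_pairP => [p q|i j k jk|j k].
- by rewrite altbC edge_sym.
- rewrite /= queen2_edge_same -?val_eqE ?neq_ltn ?jk // /altb !filter_cat.
  (* Within a row both keys increase with the column, so three blocks restrict to the same ordered
     pair and the fourth to the empty word. *)
  have ltk : (key1 (i, j) < key1 (i, k)) * (key2 (i, j) < key2 (i, k)).
    by rewrite /key1 /key2 /=; split; case: eqP => _; lia.
  rewrite !filter_block ?neq_ltn ?ltk //=.
  by case: eqP => _; rewrite /= !xpair_eqE -!val_eqE /= !eqxx (ltn_eqF jk) ?(gtn_eqF jk).
rewrite /= queen2_edge_diff /altb !filter_cat.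
rewrite !filter_block ?/key1 ?/key2 /=; try lia.
have -> : (2 * j < 2 * k + 3) = (j <= k.+1) by lia.
have -> : (2 * j + 3 < 2 * k) = ~~ (k <= j.+1) by lia.
by case: (j <= k.+1); case: (k <= j.+1); rewrite /= ?eqxx.
Qed.

End ThreeRepresentation.

(* Reduction modulo the board size keeps the coordinates computable, which
   [inord] is not. *)
Definition square m n r c : Queen m.+1 n.+1 :=
  (Ordinal (ltn_pmod r (ltn0Sn m)), Ordinal (ltn_pmod c (ltn0Sn n))).

(** * Two copies of each letter for at most four columns *)

Lemma Queen24_2representable : k_representable 2 (Queen 2 4).
Proof.
pose a : nat -> Queen 2 4 := square 1 3 0.
pose b : nat -> Queen 2 4 := square 1 3 1.
apply/k_representableP => //.
(* Each row is read twice from left to right, and the second reading of the a's follows every b.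
   Hence a_j and b_k alternate iff the first a_j lies between the two b_k, which is arranged to mean
   |j - k| <= 1. *)
exists [:: b 0; b 1; a 0; b 2; a 1; b 3; b 0; a 2; b 1; a 3; b 2; b 3;
           a 0; a 1; a 2; a 3].
split=> [|x y]; first by move=> [[[|[|//]] ?] [[|[|[|[|//]]]] ?]]; vm_compute.
move: x y => [[[|[|//]] ?] [[|[|[|[|//]]]] ?]] [[[|[|//]] ?] [[|[|[|[|//]]]] ?]];
  by vm_compute.
Qed.

Lemma Queen2_le_representable k m n :
  0 < k -> m <= n ->
  k_representable k (Queen 2 n) -> k_representable k (Queen 2 m).
Proof.
move=> k_gt0 mn.
apply: (@k_representable_induced _ (Queen 2 m) (Queen 2 n)
          (fun p => (p.1, widen_ord mn p.2))) => //.
by move=> [i j] [i' j'] [-> /val_inj->].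
Qed.

(** * Exhaustive search for words with two copies of each letter *)

Section TwoUniformWords.
Variable T : eqType.
Implicit Types (x y : T) (s w : seq T).

Fixpoint insert1 x s : seq (seq T) :=
  (x :: s) :: if s is y :: s' then map (cons y) (insert1 x s') else [::].

Fixpoint insert2 x s : seq (seq T) :=
  map (cons x) (insert1 x s) ++
  if s is y :: s' then map (cons y) (insert2 x s') else [::].

Lemma insert2_cons x y s :
  insert2 x (y :: s) =
  map (cons x) (insert1 x (y :: s)) ++ map (cons y) (insert2 x s).
Proof. by []. Qed.

(** Letters are inserted from the last of [s] to the first, and after each insertion the words that
    disagree with [e] are discarded, which keeps the search small. *)
Fixpoint rep2_words (e : rel T) s : seq (seq T) :=
  if s is x :: s' then
    [seq w <- flatten (map (insert2 x) (rep2_words e s')) |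
      all (fun y => altb x y w == e x y) s']
  else [:: [::]].

Lemma mem_insert1 x w : count_mem x w = 1 -> w \in insert1 x (filter (predC1 x) w).
Proof.
elim: w => //= z w IHw; have [-> | zx] := eqVneq z x.
  rewrite add1n => -[wx] /=; rewrite (_ : filter _ w = w).
    by case: (w) => [|? ?]; rewrite inE eqxx.
  by apply/all_filterP; rewrite all_predC has_pred1 -has_pred1 has_count wx.
rewrite add0n /= => /IHw w_in.
by rewrite inE; apply/orP; right; rewrite mem_map // => ? ? [].
Qed.

Lemma mem_insert2 x w : count_mem x w = 2 -> w \in insert2 x (filter (predC1 x) w).
Proof.
elim: w => //= z w IHw; have [-> | zx] := eqVneq z x.
  rewrite add1n => -[/mem_insert1 w_in] /=.
  have: x :: w \in map (cons x) (insert1 x (filter (predC1 x) w)).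
    by rewrite mem_map // => ? ? [].
  by case: (filter _ w) => [//|z' s] h; rewrite insert2_cons mem_cat h.
rewrite add0n => /IHw w_in; rewrite insert2_cons mem_cat.
by apply/orP; right; rewrite mem_map // => ? ? [].
Qed.

(** Completeness of the search, by induction on [s]: deleting the letter [x] from [w] does not
    affect the alternation of the other pairs, and [insert2] recovers [w]. *)
Lemma mem_rep2_words (e : rel T) s w :
  uniq s -> {subset w <= s} -> {in s, forall x, count_mem x w = 2} ->
  {in s &, forall x y, x != y -> altb x y w = e x y} -> w \in rep2_words e s.
Proof.
elim: s w => [|x s IHs] w /=.
  by case: w => // z w _ /(_ z); rewrite mem_head => /(_ isT).
case/andP=> xs s_uniq ws w2 we.
have neq y : y \in s -> y != x by apply: contraTneq => ->.
rewrite mem_filter; apply/andP; split.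
  apply/allP => y ys; apply/eqP; apply: we; rewrite ?mem_head ?inE ?ys ?orbT //.
  by rewrite eq_sym neq.
apply/flatten_mapP; exists (filter (predC1 x) w); last first.
  by apply: mem_insert2; apply: w2; rewrite mem_head.
apply: IHs => // [y|y ys|y z ys zs yz].
- by rewrite mem_filter => /andP[/= /negPf yx /ws]; rewrite inE yx.
- rewrite count_filter -(w2 y) ?inE ?ys ?orbT //.
  by apply: eq_count => z /=; case: eqP => // ->; rewrite neq.
- by rewrite altb_filter ?we ?inE ?ys ?zs ?orbT //= neq.
Qed.

End TwoUniformWords.

(** * The triangular prism as an obstruction *)

(** The prism as the Cartesian product of K_2 and K_3: the rows are the triangles, the columns the
    matching. *)
Definition prism_edge : rel ('I_2 * 'I_3) :=
  fun p q => (p != q) && ((p.1 == q.1) || (p.2 == q.2)).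

Lemma prism_edge_sym : symmetric prism_edge.
Proof.
by move=> p q; rewrite /prism_edge eq_sym (eq_sym p.1) (eq_sym p.2).
Qed.

Lemma prism_edge_irrefl : irreflexive prism_edge.
Proof. by move=> p; rewrite /prism_edge eqxx. Qed.

Definition prism : sgraph := SGraph prism_edge_sym prism_edge_irrefl.

Lemma prism_not_2representable : ~ k_representable 2 prism.
Proof.
move=> /k_representableP[] // w [w2 w_alt].
pose s : seq ('I_2 * 'I_3) :=
  [seq (i, j) | i <- [:: ord0; ord_max], j <- [:: ord0; lift ord0 ord0; ord_max]].
have s_full p : p \in s by case: p => [[[|[|//]] ?] [[|[|[|//]]] ?]].
have : w \in rep2_words prism_edge s.
  by apply: mem_rep2_words => // x y _ _; apply: w_alt.
suff -> : rep2_words prism_edge s = [::] by [].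
by vm_compute.
Qed.

Lemma Queen2_not_2representable n : 5 <= n -> ~ k_representable 2 (Queen 2 n).
Proof.
case: n => // n n5.
(* Doubling keeps distinct columns at least two apart, so no diagonal of the two-row board joins the
   chosen squares. *)
pose f (p : prism) : Queen 2 n.+1 := (p.1, inord (2 * p.2)).
have f2 p : (f p).2 = 2 * p.2 :> nat by rewrite inordK //; have := ltn_ord p.2; lia.
move=> Q2; apply: prism_not_2representable; move: Q2.
apply: (@k_representable_induced _ prism (Queen 2 n.+1) f) => //.
  move=> [i j] [i' j'] e; have := f2 (i, j); rewrite e f2 /= => jj'.
  by case: e => -> _; congr pair; apply: val_inj => /=; lia.
move=> [i j] [i' j'].
rewrite /= /queen_edge /prism_edge !xpair_eqE -!val_eqE /=.
rewrite (f2 (i, j)) (f2 (i', j')) /=.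
by have := ltn_ord i; have := ltn_ord i'; lia.
Qed.

(** * Alternation as comparability in the presence of a universal vertex *)

Section UniversalVertex.
Variable T : eqType.
Implicit Types (x y : T) (w : seq T).

(* [x] and [y] alternate, and the first occurrence, if any, is of [x]. *)
Definition leads x y w :=
  path (fun a b => a != b) y [seq z <- w | (z == x) || (z == y)].

Definition pcount w x i := count_mem x (take i w).

Lemma altb_leads x y w : x != y -> altb x y w = leads x y w || leads y x w.
Proof.
move=> xy; rewrite /altb /leads (eq_filter (fun z => orbC (z == y) (z == x))).
set u := filter _ w; have : all (fun z => (z == x) || (z == y)) u by exact: filter_all.
case: u => [|z u] //= /andP[/orP[]/eqP-> _]; rewrite eqxx /= ?orbF.
  by rewrite eq_sym xy.
by rewrite xy.
Qed.

(** Induction on [w]: a first [x] swaps the roles of the two letters, a first [y] violates the bound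
    at the prefix of length one, and any other letter changes neither count. *)
Lemma leadsP x y w : x != y ->
  leads x y w <-> forall i, pcount w y i <= pcount w x i <= (pcount w y i).+1.
Proof.
elim: w x y => [|z w IHw] x y xy; first by split=> // _ i; rewrite /pcount.
have pcountS s t i : pcount (s :: w) t i.+1 = (s == t) + pcount w t i by [].
rewrite /leads /=; have [->|zx] /= := eqVneq z x.
  rewrite eq_sym xy /=.
  have -> : path (fun a b => a != b) x [seq z <- w | (z == x) || (z == y)] = leads y x w.
    by rewrite /leads; under eq_filter do rewrite orbC.
  rewrite IHw 1?eq_sym //; split=> H i.
    case: i => [|i]; first by rewrite /pcount.
    by rewrite !pcountS eqxx (negPf xy) add0n add1n ltnS andbC; have := H i; lia.
  have := H i.+1; rewrite !pcountS eqxx (negPf xy); lia.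
have [->|zy] /= := eqVneq z y.
  rewrite eqxx /=; split=> // /(_ 1); rewrite !pcountS eqxx eq_sym (negPf xy).
  by rewrite /pcount take0 /=.
rewrite -/(leads x y w) IHw //; split=> H i.
  case: i => [|i]; first by rewrite /pcount.
  by rewrite !pcountS (negPf zx) (negPf zy); have := H i; lia.
by have := H i.+1; rewrite !pcountS (negPf zx) (negPf zy).
Qed.

Variables (c : T) (w : seq T).

(* The pointwise order on the functions e_x: the number of c's cancels. *)
Definition dominated x y := forall i,
  leads c x w + pcount w x i <= leads c y w + pcount w y i.

Lemma dominated_trans y x z : dominated x y -> dominated y z -> dominated x z.
Proof. by move=> xy yz i; apply: leq_trans (xy i) (yz i). Qed.

(** This says that e_x takes values in {0, 1}, with the number of c's moved to the other side. *)
Lemma leads_center x : x != c -> altb x c w ->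
  forall i, pcount w x i + leads c x w <= (pcount w c i).+1 /\
            pcount w c i <= pcount w x i + leads c x w.
Proof.
move=> xc; rewrite altb_leads //; case: (boolP (leads c x w)) => [|_].
  rewrite eq_sym in xc; move=> /(leadsP _ xc) cx _ i; have := cx i; lia.
by rewrite orbF => /(leadsP _ xc) xc_i i; have := xc_i i; lia.
Qed.

(** If [c] leads both letters or neither, e_x - e_y is the difference of the prefix counts; it stays
    within one, and alternation means that it never changes sign. If [c] leads exactly one letter,
    the difference is shifted by one, and the empty prefix excludes one direction of domination. *)
Lemma altb_dominated x y :
  x != c -> y != c -> x != y -> altb x c w -> altb y c w ->
  altb x y w <-> dominated x y \/ dominated y x.
Proof.
move=> xc yc xy /(leads_center xc) Cx /(leads_center yc) Cy.
have yx : y != x by rewrite eq_sym.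
have N0 z : pcount w z 0 = 0 by rewrite /pcount take0.
rewrite altb_leads // /dominated; split.
  move=> /orP[/(leadsP _ xy)|/(leadsP _ yx)]; move: Cx Cy;
  case: (leads c x w); case: (leads c y w) => /= Cx Cy D.
all: try by [left => i; have := Cx i; have := Cy i; have := D i; lia
            |right => i; have := Cx i; have := Cy i; have := D i; lia].
move=> D; apply/orP.
move: Cx Cy D.
  case: (leads c x w); case: (leads c y w) => /= Cx Cy [] D.
all: try by [left; apply/(leadsP _ xy) => i; have := Cx i; have := Cy i; have := D i; lia
            |right; apply/(leadsP _ yx) => i; have := Cx i; have := Cy i; have := D i; lia
            |have := D 0; rewrite !N0; lia].
Qed.

End UniversalVertex.

(** * The complement of the 8-cycle, and boards with at least three rows and columns *)

Lemma co_cycle8_not_comparability (R : nat -> nat -> Prop) :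
  (forall i j k, R i j -> R j k -> R i k) ->
  (forall i j, i < 8 -> j < 8 -> i != j ->
     (R i j \/ R j i) <-> (i.+1 %% 8 != j) && (j.+1 %% 8 != i)) ->
  False.
Proof.
move=> R_trans R_comp.
pose adj i j := [&& i < 8, j < 8, i != j, i.+1 %% 8 != j & j.+1 %% 8 != i].
have R_adj i j : adj i j -> R i j \/ R j i.
  by case/and5P=> i8 j8 ij a b; apply/R_comp => //; rewrite a.
have R_nadj i j : i < 8 -> j < 8 -> i != j -> ~~ adj i j -> ~ (R i j \/ R j i).
  move=> i8 j8 ij + /(R_comp _ _ i8 j8 ij)/andP[a b].
  by rewrite /adj i8 j8 ij a b.
(* If i, j and k, j are adjacent but i, k are not, the edges at j are oriented
   alike. *)
have forceL i j k : i < 8 -> k < 8 -> i != k -> ~~ adj i k -> adj k j ->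
    R i j -> R k j.
  move=> i8 k8 ik nik /R_adj[//|jk] ij.
  by case: (R_nadj i k) => //; left; apply: R_trans jk.
have forceR i j k : j < 8 -> k < 8 -> j != k -> ~~ adj j k -> adj i k ->
    R i j -> R i k.
  move=> j8 k8 jk njk /R_adj[//|ki] ij.
  by case: (R_nadj j k) => //; right; apply: R_trans ij.
(* Each link moves one end of the edge to a neighbour on the 8-cycle, that is, to a non-adjacent
   vertex; eight links reverse the edge. *)
have R04_R40 : R 0 4 -> R 4 0.
  move/(@forceL 0 4 1 isT isT isT isT isT)/(@forceL 1 4 2 isT isT isT isT isT).
  move/(@forceR 2 4 5 isT isT isT isT isT)/(@forceR 2 5 6 isT isT isT isT isT).
  move/(@forceL 2 6 3 isT isT isT isT isT)/(@forceL 3 6 4 isT isT isT isT isT).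
  by move/(@forceR 4 6 7 isT isT isT isT isT)/(@forceR 4 7 0 isT isT isT isT isT).
have R40_R04 : R 4 0 -> R 0 4.
  move/(@forceL 4 0 5 isT isT isT isT isT)/(@forceL 5 0 6 isT isT isT isT isT).
  move/(@forceR 6 0 1 isT isT isT isT isT)/(@forceR 6 1 2 isT isT isT isT isT).
  move/(@forceL 6 2 7 isT isT isT isT isT)/(@forceL 7 2 0 isT isT isT isT isT).
  by move/(@forceR 0 2 3 isT isT isT isT isT)/(@forceR 0 3 4 isT isT isT isT isT).
have [R04 R40] : R 0 4 /\ R 4 0.
  by case: (R_adj 0 4 isT) => h; split=> //; [exact: R04_R40 | exact: R40_R04].
(* A preorder may relate 0 and 4 both ways. But [R 0 4] forces [R 0 3], and with [R 4 0] this
   relates the non-adjacent 4 and 3. *)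
apply: (R_nadj 4 3) => //; left; apply: R_trans R40 _.
exact: (@forceR 0 4 3 isT isT isT isT isT).
Qed.

Lemma Queen_not_word_representable m n :
  3 <= m -> 3 <= n -> ~ word_representable (Queen m n).
Proof.
move=> m3 n3 [w /representsP[_ w_alt]].
(* A corner of size 3 x 3 suffices: [f] keeps the coordinates as numbers and hence the edges. *)
pose f (p : Queen 3 3) : Queen m n := (widen_ord m3 p.1, widen_ord n3 p.2).
have f_inj : injective f by move=> [? ?] [? ?] [/val_inj-> /val_inj->].
pose c := square 2 2 1 1.
(* The 8-cycle of non-adjacent squares. *)
pose v i := nth c [:: square 2 2 0 0; square 2 2 1 2; square 2 2 2 0;
  square 2 2 0 1; square 2 2 2 2; square 2 2 1 0; square 2 2 0 2;
  square 2 2 2 1] i.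
apply: (@co_cycle8_not_comparability
          (fun i j => dominated (f c) w (f (v i)) (f (v j)))).
  by move=> i j k; apply: dominated_trans.
move=> i j i8 j8 ij.
have vc k : k < 8 -> (v k != c) && edge (v k) c.
  by move: k; do 8?[case=> //].
have v_edge : (v i != v j) &&
    (edge (v i) (v j) == (i.+1 %% 8 != j) && (j.+1 %% 8 != i)).
  by move: i j i8 j8 ij; do 8?[case=> [|]]; last by []; do 8?[case=> [|]] => //.
have /andP[ic ice] := vc i i8; have /andP[jc jce] := vc j j8.
have /andP[vij /eqP <-] := v_edge.
have f_neq p q : p != q -> f p != f q by move=> pq; rewrite (inj_eq f_inj).
have e p q : p != q -> altb (f p) (f q) w = edge p q.
  by move=> pq; rewrite w_alt // f_neq.
rewrite -e //; apply: iff_sym.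
by apply: altb_dominated; try exact: f_neq; rewrite e.
Qed.

Theorem mainTheorem1 :
  (forall m n : nat, 1 <= m -> 1 <= n ->
     m = 1 \/ n = 1 \/ (m = 2 /\ n = 2) ->
     repr_number (Queen m n) (Some 1)) /\
  (forall n : nat, n = 3 \/ n = 4 ->
     repr_number (Queen 2 n) (Some 2) /\ repr_number (Queen n 2) (Some 2)) /\
  (forall n : nat, 5 <= n ->
     repr_number (Queen 2 n) (Some 3) /\ repr_number (Queen n 2) (Some 3)) /\
  (forall m n : nat, 3 <= m -> 3 <= n ->
     repr_number (Queen m n) None).
Proof.
split; [|split; [|split]].
- move=> m n _ _ mn; apply: repr_number1 => -[a b] [a' b'] /=.
  rewrite /queen_edge !xpair_eqE => /= ab; rewrite ab /=.
  case: mn ab => [? | [? | [? ?]]]; subst;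
    rewrite ?(ord1 a) ?(ord1 a') ?(ord1 b) ?(ord1 b') ?eqxx ?orbT //.
  by rewrite -!val_eqE /=;
    move: (ltn_ord a) (ltn_ord a') (ltn_ord b) (ltn_ord b'); lia.
- move=> n n34; have Q2 : repr_number (Queen 2 n) (Some 2).
    apply: repr_number2; first by apply: not_complete_Queen2; lia.
    by apply: Queen2_le_representable Queen24_2representable => //; lia.
  by split=> //; apply: repr_number_Queen_tr.
- move=> n n5; have Q3 : repr_number (Queen 2 n) (Some 3).
    apply: repr_number3 (Queen2_3representable n); first exact: Queen2_not_2representable.
    by apply: not_complete_Queen2; lia.
  by split=> //; apply: repr_number_Queen_tr.
- exact: Queen_not_word_representable.
Qed.
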